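(* Let $G$ be a fixed graph which is either a complete graph or a complete bipartite graph, with $v_G$ vertices and $e_G \ge 3$ edges, and put $\rho_1 := v_G/e_G$ and $\rho_2 := (v_G-2)/(e_G-1)$. Let $X_G$ denote the number of copies of $G$ in the binomial random graph $G(N,p)$. Then for every positive constant $c_1$ there is a positive constant $c_2 = c_2(G,c_1)$ such that $$\Pr\big(|X_G - \mathbb{E}(X_G)| \ge \lambda\, \mathrm{Var}(X_G)^{1/2}\big) \le e^{-c_G \lambda^2},$$ where $c_G$ is a positive constant depending only on $G$, provided $N^{-\rho_1 + c_1} \le p \le N^{-\rho_2 - c_1}$ and $8 \ln N \le \lambda \le N^{c_2}$.
   Context: $G(N,p)$ is the random graph on $N$ vertices obtained by including each edge of the complete graph $K_N$ independently with probability $p$. A copy of $G$ in a graph is a subgraph isomorphic to $G$. *)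

(* Defs.v *)
From mathcomp Require Import all_boot all_order all_algebra.
From mathcomp Require Import reals.

Set Implicit Arguments.
Unset Strict Implicit.
Unset Printing Implicit Defensive.

Import Order.TTheory GRing.Theory Num.Theory.

Local Open Scope ring_scope.

(* A simple graph on the vertex set T is given by its edge set, a set of
   two-element subsets of T, i.e. a subset of [complete_edges T]. *)
Definition complete_edges (T : finType) : {set {set T}} :=
  [set e : {set T} | #|e| == 2%N].

Definition simple_graph (T : finType) (E : {set {set T}}) : bool :=
  E \subset complete_edges T.

Definition complete_graph (T : finType) (E : {set {set T}}) : bool :=
  E == complete_edges T.

Definition complete_bipartite_graph (T : finType) (E : {set {set T}}) : Prop :=
  exists A B : {set T},
    [/\ [disjoint A & B], A :|: B = [set: T]
      & E = [set [set a; b] | a in A, b in B]].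

Section Copies.
Variables (V T : finType).

(* (W, F) is a subgraph, with vertex set W and edge set F, of the graph on T
   with edge set H. *)
Definition is_subgraph (W : {set T}) (F H : {set {set T}}) : bool :=
  (F \subset H) && [forall e in F, e \subset W].

(* The bijections V -> W are presented as the injections V -> T with image W. *)
Definition isomorphic_to (E : {set {set V}}) (W : {set T}) (F : {set {set T}})
    : bool :=
  [exists f : {ffun V -> T},
    [&& injectiveb f, [set f x | x : V] == W &
        [forall e : {set V}, (e \in E) == ([set f x | x in e] \in F)]]].

(* Copies are counted as unlabelled subgraphs: the embedding is not part of
   a copy. *)
Definition copies (E : {set {set V}}) (H : {set {set T}})
    : {set {set T} * {set {set T}}} :=
  [set S : {set T} * {set {set T}} |
    is_subgraph S.1 S.2 H && isomorphic_to E S.1 S.2].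

End Copies.

Section BinomialRandomGraph.
Variables (R : realType) (N : nat) (p : R).

Local Notation K := (complete_edges 'I_N).

(* Law of G(N,p): the product, over the edges of K_N, of the Bernoulli(p) laws
   of their presence; the sample space is [powerset K]. *)
Definition gnp_mass (H : {set {set 'I_N}}) : R :=
  \prod_(e in K) (if e \in H then p else 1 - p).

Definition gnp_Pr (A : pred {set {set 'I_N}}) : R :=
  \sum_(H in powerset K | A H) gnp_mass H.

Definition gnp_E (X : {set {set 'I_N}} -> R) : R :=
  \sum_(H in powerset K) gnp_mass H * X H.

Definition gnp_Var (X : {set {set 'I_N}} -> R) : R :=
  gnp_E (fun H => (X H - gnp_E X) ^+ 2).

(* Independence of the edges; S = set0 says that the total mass is 1. *)
Lemma gnp_Pr_subset (S : {set {set 'I_N}}) :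
  S \subset K -> gnp_Pr (fun H => S \subset H) = p ^+ #|S|.
Proof.
move=> SK.
pose F (e : {set 'I_N}) : R := if e \in K then p else 0.
pose G (e : {set 'I_N}) : R :=
  if e \in K then (if e \in S then 0 else 1 - p) else 1.
have -> : p ^+ #|S| = \prod_e (F e + G e).
  rewrite -prodr_const big_mkcond /=; apply: eq_bigr => e _.
  rewrite /F /G; have [eS|eS] := boolP (e \in S).
    by rewrite (subsetP SK _ eS) addr0.
  by case: ifP => _; rewrite ?add0r // addrC subrK.
rewrite bigA_distr /gnp_Pr big_mkcond /=; apply: eq_bigr => H _.
rewrite powersetE; have [HK|/subsetPn[e eH eK]] := boolP (H \subset K); last first.
  by rewrite (bigD1 e) //= eH /F (negbTE eK) mul0r.
have [SH|/subsetPn[e eS eH]] := boolP (S \subset H); last first.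
  by rewrite (bigD1 e) //= (negbTE eH) /G (subsetP SK _ eS) eS mul0r.
rewrite /gnp_mass big_mkcond /=; apply: eq_bigr => e _.
rewrite /F /G; case: (boolP (e \in K)) => eK.
  case: ifP => // /negbT eH; case: ifP => // eS.
  by rewrite (subsetP SH _ eS) in eH.
by case: ifP => // eH; rewrite (subsetP HK _ eH) in eK.
Qed.

End BinomialRandomGraph.

Definition copy_count (R : realType) (V : finType) (E : {set {set V}}) (N : nat)
    (H : {set {set 'I_N}}) : R :=
  #|copies E H|%:R.

(* Main.v *)
Require Import Defs.
From mathcomp Require Import all_boot all_order all_algebra.
From mathcomp Require Import reals sequences exp.
From mathcomp Require Import zify ring lra.

(** High-moment method. With q = p^e and mu = E X, write
    X - mu = \sum_a (I_a - q), the sum being over the copies a of G in K_N. In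
    the expansion of E (X - mu)^M, an M-tuple of copies contributes 0 if one of
    its members is edge-disjoint from all the others, and at most 2^M p^u
    otherwise, u being the number of edges of the union. The tuples of the
    second kind are summed by exploration. A copy together with one that meets
    it has total weight O(mu): complete and complete bipartite graphs are
    2-balanced, so that for p <= N^(-rho2) the copies meeting a given one have
    bounded total weight. Every further copy attached to the explored set has
    weight M^O(1), negligible against sqrt mu >= N^(c1/2). Hence
    E (X - mu)^M <= (O(M mu))^(M/2) as long as M is at most a small power of N.
    Since Var X >= mu/2, Markov's inequality with M of order lambda^2 concludes.
    The bounds 8 ln N <= lambda <= N^c2 force N to be large when c2 is small. *)

Set Implicit Arguments.
Unset Strict Implicit.
Unset Printing Implicit Defensive.

Import Order.TTheory GRing.Theory Num.Theory.

(** * Counting copies *)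

Section Counting.
Variables (V T : finType).

Definition copy_of (E : {set {set V}}) (f : {ffun V -> T}) :
  {set T} * {set {set T}} := ([set f x | x : V], [set f @: e | e : {set V} in E]).

(** An isomorphism fixes membership in [S.2] for images of sets under [f], and every edge of a
    subgraph lies inside the image of [f]; hence [S.2] is exactly the image of [E]. *)
Lemma copiesP (E : {set {set V}}) S :
  reflect (exists2 f : {ffun V -> T}, injective f & S = copy_of E f /\ S.2 \subset complete_edges T)
          (S \in copies E (complete_edges T)).
Proof.
apply: (iffP idP).
  rewrite inE => /andP[/andP[SK /forall_inP SW] /existsP[f /and3P[/injectiveP fi /eqP fW /forallP fF]]].
  exists f => //; split=> //; rewrite /copy_of [S]surjective_pairing; congr pair; first by rewrite fW.
  apply/setP => e; apply/idP/imsetP => [eS|[e0 e0E ->]]; last first.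
    by rewrite -(eqP (fF e0)).
  have efe : e = f @: (f @^-1: e).
    apply/setP => y; apply/idP/imsetP => [ye|[x]]; last by rewrite inE => xe ->.
    have : y \in S.1 by apply: (subsetP (SW e eS)).
    by rewrite -fW => /imsetP[x _ yx]; exists x; rewrite // inE -yx.
  by exists (f @^-1: e) => //; rewrite (eqP (fF _)) -efe.
case=> f fi [-> FK]; rewrite inE /is_subgraph FK /=; apply/andP; split.
  by apply/forall_inP => e /imsetP[e0 _ ->]; apply/subsetP => y /imsetP[x _ ->]; apply: imset_f.
apply/existsP; exists f; rewrite eqxx /=; apply/andP; split; first exact/injectiveP.
by apply/forallP => e; rewrite mem_imset //; apply: imset_inj.
Qed.

Lemma card_copy_edges E (f : {ffun V -> T}) : injective f -> #|(copy_of E f).2| = #|E|.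
Proof. by move=> fi; rewrite card_imset //; apply: imset_inj. Qed.

(** Choose a set of [#|C|] points of [V] that represent the preimages of [C], in at most [2 ^ #|V|]
    ways. They are mapped into [C] in at most [#|V| ^ #|V|] ways, and every other point of [V] has
    [#|T|] possible images. *)
Lemma card_ffun_covering (C : {set T}) :
  #|[set f : {ffun V -> T} | C \subset [set f x | x : V]]|
    <= 2 ^ #|V| * (#|V| ^ #|V| * #|T| ^ (#|V| - #|C|)).
Proof.
have [CV|VC] := leqP #|C| #|V|; last first.
  suff -> : [set f : {ffun V -> T} | C \subset [set f x | x : V]] = set0 by rewrite cards0.
  apply/setP => f; rewrite !inE.
  by apply/negP => /subset_leq_card; rewrite leqNgt (leq_ltn_trans (leq_imset_card _ _)).
pose fam (D : {set V}) := [set f : {ffun V -> T} | f \in family (fun x => [pred y | (x \in D) ==> (y \in C)])].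
apply: leq_trans (_ : #|\bigcup_(D : {set V} | #|D| == #|C|) fam D| <= _).
  apply: subset_leq_card; apply/subsetP => f; rewrite inE => Cf.
  have pre y : y \in C -> exists x, f x == y.
    by move=> /(subsetP Cf) /imsetP[x _ ->]; exists x.
  have [->|[y0 y0C]] := set_0Vmem C.
    apply/bigcupP; exists set0; rewrite ?cards0 // inE; apply/familyP => x.
    by apply/implyP; rewrite inE.
  have [x0 _] := pre y0 y0C.
  (* [g] selects a preimage of each point of [C]; the default [x0] is only reached outside the image
     of [f]. *)
  pose g y := odflt x0 [pick x | f x == y].
  have fg y : y \in C -> f (g y) = y.
    move=> /pre[x fx]; rewrite /g; case: pickP => [z /eqP //|/(_ x)].
    by rewrite fx.
  apply/bigcupP; exists (g @: C).
    rewrite card_in_imset // => y z yC zC gyz.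
    by rewrite -(fg y yC) gyz fg.
  rewrite inE; apply/familyP => x; rewrite inE /=.
  by apply/implyP => /imsetP[y yC ->]; rewrite fg.
apply: leq_trans (_ : \sum_(D : {set V} | #|D| == #|C|) #|fam D| <= _).
  apply: (big_rec2 (fun (X : {set {ffun V -> T}}) m => #|X| <= m)) => [|D m X _ hX].
    by rewrite cards0.
  by apply: leq_trans (leq_card_setU _ _) _; rewrite leq_add2l.
apply: leq_trans (_ : \sum_(D : {set V} | #|D| == #|C|) (#|V| ^ #|V| * #|T| ^ (#|V| - #|C|)) <= _).
  apply: leq_sum => D /eqP DC; rewrite cardsE card_family foldrE big_map big_enum /=.
  rewrite (bigID (mem D)) /= (eq_bigr (fun=> #|C|)) => [|x xD]; last by apply: eq_card => y; rewrite -[LHS]/((x \in D) ==> (y \in C)) xD.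
  rewrite prod_nat_const [X in _ * X](eq_bigr (fun=> #|T|)); last first.
    by move=> x /negbTE xD; apply: eq_card => y; rewrite -[LHS]/((x \in D) ==> (y \in C)) xD.
  rewrite prod_nat_const DC leq_mul //.
    have [->|] := posnP #|C|; first by rewrite expn_gt0; case: #|V|.
    by move=> C0; apply: leq_trans (leq_pexp2l _ CV); rewrite ?leq_exp2r ?(leq_trans C0).
  have -> : #|V| - #|C| = #|~: D| by rewrite -DC [RHS]cardsCs setCK.
  by apply: eq_leq; congr (_ ^ _); apply: eq_card => x; rewrite [RHS]inE.
rewrite sum_nat_const leq_mul2r; apply/orP; right.
have := card_powerset [set: V]; rewrite cardsT => <-.
by apply: subset_leq_card; apply/subsetP => D _; rewrite powersetT inE.
Qed.

Lemma card_copies_containing (E : {set {set V}}) (B : {set {set T}}) :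
  #|[set S in copies E (complete_edges T) | B \subset S.2]|
    <= 2 ^ #|V| * (#|V| ^ #|V| * #|T| ^ (#|V| - #|cover B|)).
Proof.
apply: leq_trans (card_ffun_covering (cover B)).
apply: leq_trans (leq_imset_card (copy_of E) _).
apply: subset_leq_card; apply/subsetP => S; rewrite inE => /andP[/copiesP[f fi [-> _]] BF].
apply: imset_f; rewrite inE; apply/bigcupsP => e eB.
have /imsetP[e0 _ ->] := subsetP BF e eB.
by apply/subsetP => y /imsetP[x _ ->]; apply: imset_f.
Qed.

(** Every set of [#|V|] vertices carries at least one copy. This will bound the mean from below. *)
Lemma card_copies_ge (E : {set {set V}}) : simple_graph E ->
  'C(#|T|, #|V|) <= #|copies E (complete_edges T)|.
Proof.
move=> Es; rewrite -card_draws; apply: leq_trans (leq_imset_card fst _).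
apply: subset_leq_card; apply/subsetP => W; rewrite inE => /eqP WV.
pose f : {ffun V -> T} := [ffun x => enum_val (cast_ord (esym WV) (enum_rank x))].
have fi : injective f.
  by move=> x y; rewrite !ffunE => /enum_val_inj/cast_ord_inj/enum_rank_inj.
apply/imsetP; exists (copy_of E f).
  apply/copiesP; exists f => //; split=> //; apply/subsetP => e /imsetP[e0 e0E ->].
  by rewrite inE card_imset //; have := subsetP Es e0 e0E; rewrite inE.
apply/esym/eqP; rewrite eqEcard card_imset // WV leqnn andbT.
by apply/subsetP => y /imsetP[x _ ->]; rewrite ffunE enum_valP.
Qed.

(* Such a set is the image of a map from 'I_n to S. *)
Lemma card_small_subsets (S : {set T}) n :
  #|[set B : {set T} | [&& B \subset S, B != set0 & #|B| <= n]]| <= #|S| ^ n.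
Proof.
rewrite -[X in _ ^ X]card_ord -card_ffun_on.
apply: leq_trans (leq_imset_card (fun f : {ffun 'I_n -> T} => f @: [set: 'I_n]) _).
apply: subset_leq_card; apply/subsetP => B; rewrite inE => /and3P[BS /set0Pn[x0 x0B] Bn].
apply/imsetP; exists [ffun i : 'I_n => nth x0 (enum B) i].
  apply/ffun_onP => i; rewrite ffunE; apply: (subsetP BS).
  have [iB|Bi] := ltnP i (size (enum B)); last by rewrite nth_default.
  by rewrite -mem_enum mem_nth.
apply/setP => x; apply/idP/imsetP => [xB|[i _ ->]]; last first.
  rewrite ffunE; have [iB|Bi] := ltnP i (size (enum B)); last by rewrite nth_default.
  by rewrite -mem_enum mem_nth.
have hi : index x (enum B) < n.
  by apply: leq_trans Bn; rewrite cardE index_mem mem_enum.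
by exists (Ordinal hi); rewrite // ffunE /= nth_index // mem_enum.
Qed.

End Counting.

(* 2-balancedness: (e_F - 1) / (v_F - 2) is maximal for F = G; the truncated
   subtractions are exact, as 1 < #|cover B| <= #|V| and 0 < #|B| <= #|E|. *)
Definition balanced (V : finType) (E : {set {set V}}) : Prop :=
  forall B : {set {set V}}, B \subset E -> B != set0 ->
  1 < #|cover B| /\ (#|B| - 1) * (#|V| - 2) <= (#|E| - 1) * (#|cover B| - 2).

(** * Complete and complete bipartite graphs are 2-balanced *)

Section Shapes.
Variables (V : finType) (E : {set {set V}}).

Lemma card_edges_le_bin (B : {set {set V}}) :
  B \subset complete_edges V -> #|B| <= 'C(#|cover B|, 2).
Proof.
move=> BK; rewrite -cards_draws; apply: subset_leq_card; apply/subsetP => e eB.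
by rewrite inE (bigcup_sup e) //=; have := subsetP BK e eB; rewrite inE.
Qed.

Lemma cover_gt1 (B : {set {set V}}) : B \subset complete_edges V -> B != set0 -> 1 < #|cover B|.
Proof.
move=> BK /set0Pn[e eB]; have := subsetP BK e eB; rewrite inE => /eqP <-.
by apply: subset_leq_card; apply: (bigcup_sup e).
Qed.

(** On [k > 2] vertices there are at most ['C(k, 2)] edges, and
    [('C(k, 2) - 1) / (k - 2) = (k + 1) / 2] increases with [k]. *)
Lemma complete_balanced : complete_graph E -> balanced E.
Proof.
move=> /eqP EK B BE B0; rewrite EK in BE.
split; first exact: cover_gt1.
have k1 := cover_gt1 BE B0; have := card_edges_le_bin BE.
have kV : #|cover B| <= #|V| by apply: max_card.
have -> : #|E| = 'C(#|V|, 2) by rewrite EK card_draws.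
have bin2x n : 'C(n, 2) * 2 = n * n.-1 by rewrite (bin_ffact n 2) !ffactnS ffactn0 muln1.
have := bin2x #|cover B|; have := bin2x #|V|.
move: #|cover B| #|V| #|B| 'C(#|V|, 2) 'C(#|cover B|, 2) k1 kV => k v b x y.
case: k => [|[|k]] // _; case: v => [|[|v]] // kv hx hy hb.
(* Here [k] and [v] are the vertex numbers minus 2, and ['C(k.+2, 2) - 1] equals
   [k * (k + 3) / 2]. *)
have hb' : 2 * (b - 1) <= k * (k + 3) by move: hy hb; rewrite /= mulSn mulnS; lia.
have hx' : 2 * (x - 1) = v * (v + 3) by move: hx; rewrite /= mulSn mulnS; lia.
rewrite !subSS !subn0 -(leq_pmul2l (isT : 0 < 2)) !mulnA hx'.
apply: leq_trans (_ : k * (k + 3) * v <= _); first by rewrite leq_mul2r hb' orbT.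
rewrite [leqLHS]mulnAC [leqRHS]mulnAC [v * k]mulnC leq_mul2l leq_add2r.
by apply/orP; right; move: kv; rewrite !ltnS.
Qed.

(** An edge set covering [k] vertices on one side and [l] on the other has at most [k * l] edges,
    and [(k * l - 1) / (k + l - 2)] does not decrease when [k] or [l] grows. *)
Lemma bipartite_balanced : complete_bipartite_graph E -> balanced E.
Proof.
case=> A [B [dAB ABV EE]] F FE F0.
have BnA x : x \in B -> x \notin A by move=> xB; apply/negP => xA; rewrite (disjointFr dAB xA) in xB.
have pair_inj : {in setX A B &, injective (fun x : V * V => [set x.1; x.2])}.
  move=> [a b] [a' b']; rewrite !inE /= => /andP[aA bB] /andP[aA' bB'] eqs.
  have : a \in [set a'; b'] by rewrite -eqs set21.
  have : b \in [set a'; b'] by rewrite -eqs set22.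
  rewrite !inE => /orP[/eqP bE|/eqP ->]; first by rewrite -bE (negbTE (BnA _ bB)) in aA'.
  by case/orP => /eqP aE; rewrite aE // (negbTE (BnA _ bB')) in aA *.
have cardE' (A' B' : {set V}) : A' \subset A -> B' \subset B ->
    #|[set [set a; b] | a in A', b in B']| = #|A'| * #|B'|.
  move=> AA BB; rewrite -cardsX -(card_in_imset (f := fun x : V * V => [set x.1; x.2])).
    apply: eq_card => e; apply/imset2P/imsetP => [[a b aA bB ->]|[[a b]]].
      by exists (a, b); rewrite // inE aA.
    by rewrite inE /= => /andP[aA bB] ->; exists a b.
  by move=> x y xA yA; apply: pair_inj; [move: xA|move: yA]; apply/subsetP/setXS.
have eE : #|E| = #|A| * #|B| by rewrite EE cardE'.
have FA : #|F| <= #|A :&: cover F| * #|B :&: cover F|.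
  rewrite -cardE' ?subsetIl //; apply: subset_leq_card; apply/subsetP => e eF.
  have := subsetP FE e eF; rewrite EE => /imset2P[a b aA bB eab].
  have ec : e \subset cover F by apply: (bigcup_sup e).
  by apply/imset2P; exists a b => //; rewrite inE ?aA ?bB /= (subsetP ec) // eab !inE eqxx ?orbT.
have cF : #|cover F| = #|A :&: cover F| + #|B :&: cover F|.
  rewrite -{1}(setTI (cover F)) -ABV setIUl cardsU.
  rewrite [X in _ - X](_ : _ = 0) ?subn0 //; apply/eqP; rewrite cards_eq0 setI_eq0.
  by apply: disjointW dAB; apply: subsetIl.
have cV : #|V| = #|A| + #|B|.
  by rewrite -cardsT -ABV cardsU disjoint_setI0 // cards0 subn0.
have kA : #|A :&: cover F| <= #|A| by rewrite subset_leq_card ?subsetIl.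
have kB : #|B :&: cover F| <= #|B| by rewrite subset_leq_card ?subsetIl.
have f0 : 0 < #|F| by rewrite card_gt0.
rewrite eE cF cV.
move: #|A| #|B| #|A :&: _| #|B :&: _| #|F| FA kA kB f0 => a b k l f FA kA kB f0.
have k0 : 0 < k by case: k FA {kA} => // h; rewrite leqNgt f0 in h.
have l0 : 0 < l by case: l FA {kB} => // h; rewrite muln0 leqNgt f0 in h.
split; first by lia.
apply: leq_trans (_ : (k * l - 1) * (a + b - 2) <= _); first by rewrite leq_mul2r leq_sub2r ?orbT.
have [u ->] : exists u, a = k + u by exists (a - k); lia.
have [w ->] : exists w, b = l + w by exists (b - l); lia.
(* Lowering [k] and [l] by 1 removes the subtractions; the two sides then differ by the nonnegative
   [k * (k + u) * w + l * (l + w) * u]. *)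
case: k l k0 l0 {FA kA kB} => [//|k] [//|l] _ _.
have -> : k.+1 * l.+1 - 1 = k + l + k * l by lia.
have -> : k.+1 + u + (l.+1 + w) - 2 = k + u + (l + w) by lia.
have -> : (k.+1 + u) * (l.+1 + w) - 1 = (k + u) + (l + w) + (k + u) * (l + w) by nia.
have -> : k.+1 + l.+1 - 2 = k + l by lia.
have -> : ((k + u) + (l + w) + (k + u) * (l + w)) * (k + l) =
  (k + l + k * l) * (k + u + (l + w)) + k * (k + u) * w + l * (l + w) * u by ring.
lia.
Qed.

End Shapes.

Local Open Scope ring_scope.

(** * Moments of the edge-containment indicators *)

Section Gnp.
Variables (R : realType) (N : nat) (p : R).
Hypothesis p01 : 0 <= p <= 1.
Local Notation K := (complete_edges 'I_N).
Local Notation Ex := (gnp_E p).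
Implicit Types (X Y : {set {set 'I_N}} -> R) (H : {set {set 'I_N}}).

Lemma gnp_mass_ge0 H : 0 <= gnp_mass p H.
Proof. by apply: prodr_ge0 => e _; case: ifP => _; move: p01; lra. Qed.

Lemma eq_gnp_E X Y : (forall H, H \subset K -> X H = Y H) -> Ex X = Ex Y.
Proof. by move=> XY; apply: eq_bigr => H; rewrite powersetE => /XY ->. Qed.

Lemma gnp_E_sum (J : finType) (P : pred J) (X : J -> {set {set 'I_N}} -> R) :
  Ex (fun H => \sum_(j | P j) X j H) = \sum_(j | P j) Ex (X j).
Proof.
rewrite /gnp_E exchange_big /=; apply: eq_bigr => H _.
by rewrite mulr_sumr.
Qed.

Lemma gnp_EZ (c : R) X : Ex (fun H => c * X H) = c * Ex X.
Proof. by rewrite /gnp_E mulr_sumr; apply: eq_bigr => H _; rewrite mulrCA. Qed.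

Lemma gnp_E_subset (S : {set {set 'I_N}}) : S \subset K -> Ex (fun H => (S \subset H)%:R) = p ^+ #|S|.
Proof.
move=> SK; rewrite -(gnp_Pr_subset p SK) /gnp_Pr big_mkcondr /=.
by apply: eq_bigr => H _; case: ifP => _; rewrite ?mulr1 ?mulr0.
Qed.

Lemma gnp_markov (X : {set {set 'I_N}} -> R) (t : R) (n : nat) :
  0 < t -> ~~ odd n ->
  gnp_Pr p (fun H => `|X H| >= t) <= Ex (fun H => X H ^+ n) / t ^+ n.
Proof.
move=> t0 evn; rewrite ler_pdivlMr ?exprn_gt0 // /gnp_Pr mulr_suml.
rewrite big_mkcondr /=; apply: ler_sum => H _.
have Xn0 : X H ^+ n = `|X H| ^+ n by rewrite -normrX ger0_norm ?exprn_even_ge0.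
case: ifP => tX; last first.
  by rewrite mulr_ge0 ?gnp_mass_ge0 // Xn0 exprn_ge0.
rewrite ler_wpM2l ?gnp_mass_ge0 // Xn0.
by apply: lerXn2r tX; rewrite nnegrE ?normr_ge0 // ltW.
Qed.

Variables (I : finType) (A : I -> {set {set 'I_N}}) (e : nat).
Hypothesis AK : forall i, A i \subset K.
Hypothesis cardA : forall i, #|A i| = e.

Local Notation q := (p ^+ e).

Let p_ge0 : 0 <= p. Proof. by case/andP: p01. Qed.
Let p_le1 : p <= 1. Proof. by case/andP: p01. Qed.

Section Product.
Variables (n : nat) (t : {ffun 'I_n -> I}).

Let Un (S : {set 'I_n}) := \bigcup_(i in S) A (t i).

(** Expand the product, [S] being the set of factors that contribute their indicator; the product of
    these indicators is the indicator of containing [Un S]. *)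
Lemma gnp_E_prod_centered :
  Ex (fun H => \prod_(i < n) ((A (t i) \subset H)%:R - q)) =
  \sum_(S : {set 'I_n}) (\prod_i (if i \in S then 1 else - q)) * p ^+ #|Un S|.
Proof.
transitivity (Ex (fun H => \sum_(S : {set 'I_n})
    (\prod_i (if i \in S then 1 else - q)) * (Un S \subset H)%:R)); last first.
  rewrite gnp_E_sum; apply: eq_bigr => S _; rewrite gnp_EZ gnp_E_subset //.
  by apply/bigcupsP => i _; apply: AK.
apply: eq_gnp_E => H _; rewrite bigA_distr; apply: eq_bigr => S _ /=.
have -> : (Un S \subset H)%:R = \prod_i (if i \in S then (A (t i) \subset H)%:R else 1) :> R.
  have [/bigcupsP UH|] := boolP (Un S \subset H).
    by rewrite big1 // => i _; case: ifP => // /UH ->.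
  move=> /bigcupsP nUH.
  have [i iS nAH] : exists2 i, i \in S & ~~ (A (t i) \subset H).
    apply/exists_inP; rewrite -[X in is_true X]negbK negb_exists_in.
    by apply/negP => /forall_inP h; apply: nUH => i /h; rewrite negbK.
  by rewrite (bigD1 i) //= iS (negbTE nAH) mul0r.
rewrite -big_split /=; apply: eq_bigr => i _.
by case: ifP; rewrite ?mul1r ?mulr1.
Qed.

(* Toggling the membership of i0 flips the sign of the summands of the
   expansion of gnp_E_prod_centered. *)
Lemma gnp_E_prod_isolated (i0 : 'I_n) :
  (forall j, j != i0 -> [disjoint A (t i0) & A (t j)]) ->
  Ex (fun H => \prod_(i < n) ((A (t i) \subset H)%:R - q)) = 0.
Proof.
move=> disj; rewrite gnp_E_prod_centered.
pose tog (S : {set 'I_n}) := if i0 \in S then S :\ i0 else i0 |: S.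
have togE S i : (i \in tog S) = (if i == i0 then i \notin S else i \in S).
  rewrite /tog; have [->|ne] := eqVneq i i0.
    by case: ifP => iS; rewrite !inE eqxx ?iS.
  by case: ifP => _; rewrite !inE ?ne // (negbTE ne).
have togK : involutive tog.
  by move=> S; apply/setP => i; rewrite !togE; case: eqP => // _; rewrite negbK.
pose h (S : {set 'I_n}) := (\prod_(i | i != i0) (if i \in S then 1 else - q)) *
   p ^+ #|Un (S :\ i0)|.
pose f (S : {set 'I_n}) := (\prod_i (if i \in S then 1 else - q)) * p ^+ #|Un S|.
(* Since the copy at [i0] shares no edge with the others, its contribution splits off: [q] from its
   indicator, or [- q] from the constant. *)
have fE S : f S = (if i0 \in S then q else - q) * h S.
  rewrite /f /h (bigD1 i0) //= -!mulrA.
  case: ifP => iS; last first.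
    by congr (_ * (_ * p ^+ #|Un _|)); apply/setP => i; rewrite !inE; case: eqP => // ->.
  rewrite mul1r mulrCA; congr (_ * _).
  have -> : Un S = A (t i0) :|: Un (S :\ i0).
    by rewrite /Un (bigD1 i0) //=; congr (_ :|: _); apply: eq_bigl => i; rewrite !inE andbC.
  rewrite -(cardA (t i0)) -exprD cardsU (_ : A (t i0) :&: _ = set0) ?cards0 ?subn0 //.
  apply: disjoint_setI0; apply: bigcup_disjoint => i; rewrite !inE => /andP[ne _].
  exact: disj.
have hE S : h (tog S) = h S.
  rewrite /h; congr (_ * p ^+ #|Un _|).
    by apply: eq_bigr => i ne; rewrite togE (negbTE ne).
  by apply/setP => i; rewrite !inE togE; case: eqP.
have ff S : f (tog S) = - f S.
  rewrite !fE hE togE eqxx; case: (i0 \in S) => /=; rewrite ?mulNr //.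
  by rewrite opprK.
have : \sum_S f S = - \sum_S f S.
  rewrite {1}(reindex_inj (inv_inj togK)) /= -sumrN.
  by apply: eq_bigr => S _; rewrite ff.
by rewrite /f => /eqP; rewrite -addr_eq0 -mulr2n mulrn_eq0 /= => /eqP.
Qed.

(** Each of the [2 ^+ n] terms has absolute value [p] to the power [e * #|~: S| + #|Un S|], and this
    exponent is at least the size of the whole union. *)
Lemma gnp_E_prod_le :
  Ex (fun H => \prod_(i < n) ((A (t i) \subset H)%:R - q)) <=
  2 ^+ n * p ^+ #|\bigcup_i A (t i)|.
Proof.
rewrite gnp_E_prod_centered.
have -> : 2 ^+ n * p ^+ #|\bigcup_i A (t i)| =
    \sum_(S : {set 'I_n}) p ^+ #|\bigcup_i A (t i)|.
  rewrite sumr_const -[RHS]mulr_natl; congr (_ * _).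
  have := card_powerset [set: 'I_n]; rewrite powersetT !cardsT card_ord => ->.
  by rewrite natrX.
apply: ler_sum => S _; apply: le_trans (ler_norm _) _.
rewrite normrM [X in _ * X]ger0_norm ?exprn_ge0 ?p_ge0 // normr_prod.
have -> : \prod_i `|if i \in S then 1 else - q : R| = p ^+ (e * #|~: S|)%N.
  rewrite exprM -prodr_const [RHS]big_mkcond /=; apply: eq_bigr => i _.
  by rewrite inE; case: ifP => _; rewrite ?normr1 // normrN ger0_norm ?exprn_ge0 ?p_ge0.
rewrite -exprD ler_wiXn2l ?p_ge0 ?p_le1 //.
have -> : \bigcup_i A (t i) = Un S :|: Un (~: S).
  by rewrite /Un -bigcup_setU setUCr; apply: eq_bigl => i; rewrite inE.
rewrite addnC; apply: leq_trans (leq_card_setU _ _) _; rewrite leq_add2l.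
rewrite mulnC -sum_nat_const; apply: (big_rec2 (fun (X : {set {set 'I_N}}) m => #|X| <= m)%N).
  by rewrite cards0.
move=> i m X _ hX; rewrite -(cardA (t i)).
by apply: leq_trans (leq_card_setU _ _) _; rewrite leq_add2l.
Qed.

End Product.
End Gnp.

(** * Tuples of copies without isolated members *)

Definition ffun_remove (I : finType) (n : nat) (i : 'I_n.+1)
  (t : {ffun 'I_n.+1 -> I}) : {ffun 'I_n -> I} := [ffun k => t (lift i k)].

(** Splitting off coordinate [i] is a bijection, with inverse [ins]. It lets the exploration take
    any chosen member out of a tuple. *)
Lemma sum_ffun_remove (R : nmodType) (I : finType) (n : nat) (i : 'I_n.+1)
    (F : I -> {ffun 'I_n -> I} -> R) :
  \sum_(t : {ffun 'I_n.+1 -> I}) F (t i) (ffun_remove i t) = \sum_a \sum_u F a u.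
Proof.
pose ins (x : I * {ffun 'I_n -> I}) : {ffun 'I_n.+1 -> I} :=
  [ffun k => if unlift i k is Some k' then x.2 k' else x.1].
have insi x : ins x i = x.1 by rewrite ffunE unlift_none.
have insr x : ffun_remove i (ins x) = x.2.
  by apply/ffunP => k; rewrite !ffunE liftK.
rewrite pair_big /= (reindex_onto ins (fun t => (t i, ffun_remove i t))) /=.
  by apply: eq_big => [x|x _]; rewrite insi insr // -surjective_pairing eqxx.
move=> t _; apply/ffunP => k; rewrite /ins ffunE /=.
by case: unliftP => [j|] ->; rewrite ?ffunE.
Qed.

Section Clusters.
Variables (R : realFieldType) (U I : finType) (A : I -> {set U}) (p : R).
Hypothesis p01 : 0 <= p <= 1.

Definition meets (S : {set U}) (a : I) : bool := ~~ [disjoint A a & S].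

(* S is the set of edges explored so far. *)
Definition anchored (n : nat) (S : {set U}) (t : {ffun 'I_n -> I}) : bool :=
  [forall i, meets S (t i) || [exists j, (j != i) && meets (A (t j)) (t i)]].

Definition tuple_weight (n : nat) (S : {set U}) (t : {ffun 'I_n -> I}) : R :=
  p ^+ #|(\bigcup_i A (t i)) :\: S|.

Definition anchored_sum (n : nat) (S : {set U}) : R :=
  \sum_(t : {ffun 'I_n -> I} | anchored S t) tuple_weight S t.

(** In the random graph this is the expected number of copies sharing an edge with [S],
    conditionally on [S] being present. *)
Definition meeting_weight (S : {set U}) : R :=
  \sum_(b | meets S b) p ^+ #|A b :\: S|.

Lemma tuple_weight_ge0 n S (t : {ffun 'I_n -> I}) : 0 <= tuple_weight S t.
Proof. by apply: exprn_ge0; case/andP: p01. Qed.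

Lemma meets_set0 a : meets set0 a = false.
Proof. by rewrite /meets -setI_eq0 setI0 eqxx. Qed.

Lemma meetsS (S S' : {set U}) a : S \subset S' -> meets S a -> meets S' a.
Proof. by move=> SS'; apply: contra; apply: disjointWr. Qed.

(** A member that relied on the removed one now meets the enlarged explored set. *)
Lemma anchored_remove n S (t : {ffun 'I_n.+1 -> I}) i :
  anchored S t -> anchored (S :|: A (t i)) (ffun_remove i t).
Proof.
move=> /forallP anc; apply/forallP => k; rewrite ffunE.
case/orP: (anc (lift i k)) => [h|/existsP[j /andP[ji hj]]].
  by rewrite (meetsS (subsetUl _ _) h).
have [k' jE|jE] := unliftP i j; last first.
  by move: hj; rewrite jE => hj; rewrite (meetsS (subsetUr _ _) hj).
apply/orP; right; apply/existsP; exists k'; rewrite ffunE -jE hj andbT.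
by apply: contra ji; rewrite jE => /eqP ->.
Qed.

Lemma tuple_weight_remove n S (t : {ffun 'I_n.+1 -> I}) i :
  tuple_weight S t =
  p ^+ #|A (t i) :\: S| * tuple_weight (S :|: A (t i)) (ffun_remove i t).
Proof.
rewrite /tuple_weight -exprD; congr (_ ^+ _).
have -> : \bigcup_j A (t j) = A (t i) :|: \bigcup_j A (ffun_remove i t j).
  apply/setP => x; rewrite inE; apply/bigcupP/orP => [[j _ xj]|[xi|/bigcupP[k _]]].
  - have [k jE|<-] := unliftP i j; last by left.
    by right; apply/bigcupP; exists k; rewrite // ffunE -jE.
  - by exists i.
  - by rewrite ffunE => xk; exists (lift i k).
set B := \bigcup_j _.
have -> : (A (t i) :|: B) :\: S = (A (t i) :\: S) :|: (B :\: (S :|: A (t i))).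
  by apply/setP => x; rewrite !inE; do !case: (x \in _).
rewrite cardsU (_ : _ :&: (B :\: _) = set0) ?cards0 ?subn0 //.
by apply/setP => x; rewrite !inE; do !case: (x \in _).
Qed.

(** Union bound over the position [i] of a member meeting [S]; that member is then absorbed into the
    explored set. *)
Lemma anchored_sum_hit_le n S :
  \sum_(t : {ffun 'I_n.+1 -> I} | anchored S t && [exists i, meets S (t i)])
     tuple_weight S t <=
  n.+1%:R * \sum_(b | meets S b) p ^+ #|A b :\: S| * anchored_sum n (S :|: A b).
Proof.
pose F b (u : {ffun 'I_n -> I}) := if meets S b && anchored (S :|: A b) u then
  p ^+ #|A b :\: S| * tuple_weight (S :|: A b) u else 0.
have F0 b u : 0 <= F b u.
  rewrite /F; case: ifP => // _.
  by rewrite mulr_ge0 ?tuple_weight_ge0 // exprn_ge0; case/andP: p01.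
apply: le_trans (_ : \sum_(t : {ffun 'I_n.+1 -> I}) \sum_i F (t i) (ffun_remove i t) <= _).
  rewrite big_mkcond; apply: ler_sum => t _; case: ifP => [/andP[anc]|_]; last first.
    by apply: sumr_ge0.
  case/existsP=> i hi; rewrite (bigD1 i) //= (tuple_weight_remove S t i) {1}/F hi anchored_remove //.
  by rewrite lerDl sumr_ge0.
rewrite exchange_big /= (eq_bigr _ (fun i _ => sum_ffun_remove i F)).
rewrite sumr_const card_ord -[leLHS]mulr_natl ler_wpM2l ?ler0n //.
rewrite [leRHS]big_mkcond; apply: ler_sum => b _; rewrite /F.
case: (meets S b) => /=; last by rewrite big1.
by rewrite -big_mkcond /= mulr_sumr.
Qed.

(* Either no member of the tuple meets S, and the tuple is anchored by itself,
   or a member that meets S can be moved into S. *)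
Lemma anchored_sumS_le n S :
  anchored_sum n.+1 S <= anchored_sum n.+1 set0 +
  n.+1%:R * \sum_(b | meets S b) p ^+ #|A b :\: S| * anchored_sum n (S :|: A b).
Proof.
apply: le_trans (lerD (lexx _) (anchored_sum_hit_le n S)).
rewrite /anchored_sum (bigID (fun t : {ffun _} => [exists i, meets S (t i)])) /= addrC.
rewrite lerD2r [leLHS]big_mkcond [leRHS]big_mkcond /=; apply: ler_sum => t _.
case: ifP => [/andP[/forallP anc]|_]; last first.
  by case: ifP => // _; apply: tuple_weight_ge0.
rewrite negb_exists => /forallP nS.
have -> : anchored set0 t.
  by apply/forallP => i; move: (anc i); rewrite (negbTE (nS i)) meets_set0.
rewrite /tuple_weight setD0 (_ : _ :\: S = \bigcup_i A (t i)) //.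
apply/setDidPl; rewrite disjoint_sym; apply: bigcup_disjoint => i _.
by move: (nS i); rewrite negbK disjoint_sym.
Qed.

(* The first member of the tuple becomes the explored set; since it is not
   isolated, some other member meets it. *)
Lemma anchored_sum_set0_le n :
  anchored_sum n.+2 set0 <=
  \sum_a p ^+ #|A a| * (n.+1%:R *
     \sum_(b | meets (A a) b) p ^+ #|A b :\: A a| * anchored_sum n (A a :|: A b)).
Proof.
pose F a (u : {ffun 'I_n.+1 -> I}) :=
  if anchored (A a) u && [exists i, meets (A a) (u i)] then
  p ^+ #|A a| * tuple_weight (A a) u else 0.
have F0 b u : 0 <= F b u.
  rewrite /F; case: ifP => // _.
  by rewrite mulr_ge0 ?tuple_weight_ge0 // exprn_ge0; case/andP: p01.
apply: le_trans (_ : \sum_(t : {ffun 'I_n.+2 -> I}) F (t ord0) (ffun_remove ord0 t) <= _).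
  rewrite /anchored_sum big_mkcond; apply: ler_sum => t _; case: ifP => // anc.
  rewrite (tuple_weight_remove _ _ ord0) /F.
  have := anchored_remove ord0 anc; rewrite !set0U setD0 => -> /=.
  case: ifP => // /existsP[]; move/forallP: anc => /(_ ord0).
  rewrite meets_set0 /= => /existsP[j /andP[j0 hj]].
  have [k jE|jE] := unliftP ord0 j; last by rewrite jE eqxx in j0.
  exists k; rewrite ffunE -jE; move: hj; rewrite /meets; apply: contra.
  by rewrite disjoint_sym.
rewrite sum_ffun_remove; apply: ler_sum => a _; rewrite -big_mkcond /= -mulr_sumr.
rewrite ler_wpM2l ?anchored_sum_hit_le // exprn_ge0 //; by case/andP: p01.
Qed.

Lemma anchored_sum0 S : anchored_sum 0 S = 1.
Proof.
rewrite /anchored_sum (eq_bigl predT); last by move=> t; apply/forallP; case.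
rewrite (eq_bigr (fun=> 1)) => [|t _].
  by rewrite sumr_const card_ffun card_ord expn0.
by rewrite /tuple_weight big_ord0 set0D cards0.
Qed.

Lemma anchored_sum1 : anchored_sum 1 set0 = 0.
Proof.
rewrite /anchored_sum big_pred0 // => t; apply/forallP => /(_ ord0).
by rewrite meets_set0 /= => /existsP[j]; rewrite ord1.
Qed.

Variables (e M : nat) (C D s : R).
Hypothesis cardA : forall a, #|A a| = e.
Hypothesis meetC : forall a, meeting_weight (A a) <= C.
Hypothesis meetD : forall S : {set U}, (#|S| <= e * M)%N -> meeting_weight S <= D.
Hypothesis s_ge0 : 0 <= s.
Hypothesis sC : 2 * C * M%:R * (#|I|%:R * p ^+ e) <= s ^+ 2.
Hypothesis sD : 2 * M%:R * D <= s.

(** Strong induction on [n]. From the empty set, a first copy and one meeting it cost at most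
    [s ^+ 2] by [sC]. From an explored set [S], either no member meets [S], or one is absorbed at
    cost [2 * M%:R * D <= s]; the two cases give the factor 2. The condition on [#|S| + e * n] keeps
    every explored set within the range of [meetD]. *)
Lemma anchored_sum_bound n : (n <= M)%N ->
  anchored_sum n set0 <= s ^+ n /\
  forall S : {set U}, (#|S| + e * n <= e * M)%N -> anchored_sum n S <= 2 * s ^+ n.
Proof.
have p0 : 0 <= p by case/andP: p01.
have step (S : {set U}) (m : nat) : (forall b, meets S b -> anchored_sum m (S :|: A b) <= 2 * s ^+ m) ->
    \sum_(b | meets S b) p ^+ #|A b :\: S| * anchored_sum m (S :|: A b) <=
    meeting_weight S * (2 * s ^+ m).
  move=> h; rewrite mulr_suml; apply: ler_sum => b bS.
  by rewrite ler_wpM2l ?exprn_ge0 ?h.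
have sub (S : {set U}) a m : (#|S| + e * m.+1 <= e * M)%N -> (#|S :|: A a| + e * m <= e * M)%N.
  move=> h; apply: leq_trans h; rewrite mulnS addnA leq_add2r -(cardA a).
  exact: leq_card_setU.
have H0 m : (m.+2 <= M)%N -> (forall S : {set U}, (#|S| + e * m <= e * M)%N -> anchored_sum m S <= 2 * s ^+ m) ->
    anchored_sum m.+2 set0 <= s ^+ m.+2.
  move=> mM IH; apply: le_trans (anchored_sum_set0_le m) _.
  apply: le_trans (_ : \sum_(a : I) p ^+ e * (M%:R * (C * (2 * s ^+ m))) <= _).
    apply: ler_sum => a _; rewrite cardA ler_wpM2l ?exprn_ge0 //.
    apply: ler_pM; rewrite ?ler0n //; last 2 first.
    - by rewrite ler_nat ltnW.
    - apply: le_trans (step _ _ _) _.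
        move=> b _; apply/IH/sub; rewrite cardA -mulnS leq_mul2l mM orbT //.
      by rewrite ler_wpM2r // mulr_ge0 ?exprn_ge0.
    apply: sumr_ge0 => b _; rewrite mulr_ge0 ?exprn_ge0 //.
    by apply: sumr_ge0 => t _; apply: tuple_weight_ge0.
  rewrite sumr_const -[leLHS]mulr_natl.
  rewrite (_ : _ * _ = 2 * C * M%:R * (#|I|%:R * p ^+ e) * s ^+ m); last by ring.
  by rewrite [leRHS](exprD s 2 m) ler_wpM2r ?exprn_ge0.
elim/ltn_ind: n => m IH mM.
have fm : anchored_sum m set0 <= s ^+ m.
  case: m IH mM => [|[|m]] IH mM.
  - by rewrite anchored_sum0.
  - by rewrite anchored_sum1 expr1.
  - exact: (H0 m mM (IH m (ltnW (ltnSn m.+1)) (ltnW (ltnW mM))).2).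
split=> // S; case: m IH mM fm => [|m] IH mM fm Sm.
  by rewrite anchored_sum0 expr0 mulr1 ler1n.
apply: le_trans (anchored_sumS_le m S) _.
have -> : 2 * s ^+ m.+1 = s ^+ m.+1 + s * s ^+ m by rewrite exprS; ring.
apply: lerD => //.
apply: le_trans (_ : M%:R * (D * (2 * s ^+ m)) <= _); last first.
  rewrite (_ : _ * _ = 2 * M%:R * D * s ^+ m); last by ring.
  by rewrite ler_wpM2r ?exprn_ge0.
apply: ler_pM; rewrite ?ler0n ?ler_nat //.
  apply: sumr_ge0 => b _; rewrite mulr_ge0 ?exprn_ge0 //.
  by apply: sumr_ge0 => t _; apply: tuple_weight_ge0.
apply: le_trans (step _ _ _) _.
  by move=> b _; apply: (IH m (ltnSn m) (ltnW mM)).2; apply: sub.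
rewrite ler_wpM2r ?mulr_ge0 ?exprn_ge0 //; apply: meetD.
by apply: leq_trans Sm; apply: leq_addr.
Qed.
End Clusters.

(** * Concentration from moments *)

Section Concentration.
Variables (R : realType) (N : nat) (p : R).
Hypothesis p01 : 0 <= p <= 1.
Local Notation K := (complete_edges 'I_N).
Local Notation Ex := (gnp_E p).
Variables (I : finType) (A : I -> {set {set 'I_N}}) (e : nat).
Hypothesis AK : forall i, A i \subset K.
Hypothesis cardA : forall i, #|A i| = e.
Local Notation q := (p ^+ e).
Local Notation mu := (#|I|%:R * q).

Definition contained_count (H : {set {set 'I_N}}) : R := \sum_a (A a \subset H)%:R.
Local Notation X := contained_count.

Lemma gnp_E_count : Ex X = mu.
Proof.
rewrite gnp_E_sum (eq_bigr (fun=> q)) ?sumr_const ?mulr_natl //.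
by move=> a _; rewrite gnp_E_subset // cardA.
Qed.

Lemma count_centered H : X H - mu = \sum_a ((A a \subset H)%:R - q).
Proof. by rewrite sumrB sumr_const mulr_natl. Qed.

(** Expand the power over [M]-tuples of copies. A tuple that is not anchored at [set0] has an
    isolated member and vanishes; [gnp_E_prod_le] bounds the others. *)
Lemma central_moment_le M :
  Ex (fun H => (X H - mu) ^+ M) <= 2 ^+ M * anchored_sum A p M set0.
Proof.
have -> : Ex (fun H => (X H - mu) ^+ M) =
    \sum_(t : {ffun 'I_M -> I}) Ex (fun H => \prod_(i < M) ((A (t i) \subset H)%:R - q)).
  rewrite -gnp_E_sum; apply: eq_gnp_E => H _.
  by rewrite count_centered -[in LHS](card_ord M) -prodr_const bigA_distr_bigA.
rewrite /anchored_sum mulr_sumr [leRHS]big_mkcond; apply: ler_sum => t _.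
case: ifP => [_|/forallPn[i]].
  by rewrite /tuple_weight setD0; apply: gnp_E_prod_le.
rewrite meets_set0 /= negb_exists => /forallP iso.
rewrite (gnp_E_prod_isolated p AK cardA (i0 := i)) // => j ji.
by move: (iso j); rewrite ji /= negbK.
Qed.

Lemma gnp_E_pair_centered a b :
  Ex (fun H => ((A a \subset H)%:R - q) * ((A b \subset H)%:R - q)) =
  p ^+ #|A a :|: A b| - q ^+ 2.
Proof.
have EB (Y Z : {set {set 'I_N}} -> R) : Ex (fun H => Y H - Z H) = Ex Y - Ex Z.
  by rewrite /gnp_E -sumrB; apply: eq_bigr => H _; rewrite mulrBr.
have E1 (c : R) : Ex (fun _ : {set {set 'I_N}} => c) = c.
  transitivity (c * Ex (fun H : {set {set 'I_N}} => (set0 \subset H)%:R)).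
    by rewrite -gnp_EZ; apply: eq_gnp_E => H _; rewrite sub0set mulr1.
  by rewrite gnp_E_subset ?sub0set // cards0 mulr1.
transitivity (Ex (fun H => ((A a :|: A b \subset H)%:R - q * (A a \subset H)%:R) -
   (q * (A b \subset H)%:R - q ^+ 2))).
  apply: eq_gnp_E => H _; rewrite subUset.
  by case: (A a \subset H); case: (A b \subset H) => /=; ring.
rewrite 3!EB !gnp_EZ !gnp_E_subset ?subUset ?AK // E1 !cardA.
move: (p ^+ #|A a :|: A b|) (p ^+ e) => u w; ring.
Qed.

(** All covariances are nonnegative, and each diagonal term is [q - q ^+ 2 >= q / 2]. *)
Lemma gnp_Var_count_ge : q <= 2^-1 -> mu / 2 <= gnp_Var p X.
Proof.
move=> q2; rewrite /gnp_Var gnp_E_count.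
have -> : Ex (fun H => (X H - mu) ^+ 2) = \sum_a \sum_b (p ^+ #|A a :|: A b| - q ^+ 2).
  transitivity (\sum_a \sum_b Ex (fun H => ((A a \subset H)%:R - q) * ((A b \subset H)%:R - q))).
    under eq_bigr do rewrite -gnp_E_sum.
    rewrite -gnp_E_sum; apply: eq_gnp_E => H _.
    rewrite count_centered expr2 mulr_suml; apply: eq_bigr => a _.
    by rewrite mulr_sumr.
  by apply: eq_bigr => a _; apply: eq_bigr => b _; apply: gnp_E_pair_centered.
have -> : mu / 2 = \sum_(a : I) (q / 2) by rewrite sumr_const -[RHS]mulr_natl mulrA.
apply: ler_sum => a _.
have q0 : 0 <= q by rewrite exprn_ge0; case/andP: p01.
rewrite (bigD1 a) //= setUid cardA -[leLHS]addr0; apply: lerD.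
  by nra.
apply: sumr_ge0 => b _; rewrite subr_ge0 -exprM; case/andP: p01 => p0 p1.
apply: ler_wiXn2l => //; rewrite muln2 -addnn -{1}(cardA a) -(cardA b).
exact: leq_card_setU.
Qed.

(** Markov's inequality at the even exponent [m.*2]. With variance at least [mu / 2], the resulting
    ratio is at most the [m]-th power of [16 * C * m.*2%:R / lambda ^+ 2], which is at most
    [expR (- 1)]. *)
Lemma count_tail (m : nat) (C D lambda : R) :
  q <= 2^-1 -> 0 < mu -> 0 < C -> 0 <= D -> 0 < lambda ->
  (forall a, meeting_weight A p (A a) <= C) ->
  (forall S : {set {set 'I_N}}, (#|S| <= e * m.*2)%N -> meeting_weight A p S <= D) ->
  (2 * m.*2%:R * D) ^+ 2 <= 2 * C * m.*2%:R * mu ->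
  16 * C * m.*2%:R * expR 1 <= lambda ^+ 2 ->
  gnp_Pr p (fun H => `|X H - Ex X| >= lambda * Num.sqrt (gnp_Var p X)) <= expR (- m%:R).
Proof.
move=> q2 mu0 C0 D0 l0 hC hD hDm hl.
set V := gnp_Var p X; have hV : mu / 2 <= V by apply: gnp_Var_count_ge.
have V0 : 0 < V by apply: lt_le_trans hV; rewrite divr_gt0.
apply: le_trans (gnp_markov p01 (n := m.*2) _ _ _) _.
- by rewrite mulr_gt0 ?sqrtr_gt0.
- by rewrite odd_double.
rewrite ler_pdivrMr ?exprn_gt0 ?mulr_gt0 ?sqrtr_gt0 // gnp_E_count.
apply: le_trans (central_moment_le _) _.
(* Taking [s = Num.sqrt T] turns the hypothesis [sC] of [anchored_sum_bound] into an equality. *)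
set T := 2 * C * m.*2%:R * mu in hDm.
have T0 : 0 <= T by apply: le_trans (sqr_ge0 _) hDm.
have [] := @anchored_sum_bound R _ I A p p01 e m.*2 C D (Num.sqrt T) cardA hC hD (sqrtr_ge0 _) _ _ m.*2 (leqnn _).
- by rewrite sqr_sqrtr.
- by rewrite -[leLHS]ger0_norm ?mulr_ge0 // -sqrtr_sqr ler_wsqrtr.
move=> hs _; apply: le_trans (ler_wpM2l _ hs) _; first by rewrite exprn_ge0.
rewrite -exprMn -mul2n 2!exprM !(exprMn 2) !sqr_sqrtr ?(ltW V0) //.
have -> : expR (- m%:R) = (expR (- 1)) ^+ m :> R by rewrite -expRM_natl mulr_natl mulNrn.
rewrite -exprMn; apply: lerXn2r; rewrite ?nnegrE.
- by rewrite mulr_ge0 ?sqr_ge0.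
- by rewrite !mulr_ge0 ?expR_ge0 ?sqr_ge0 // ltW.
rewrite expRN [leRHS]mulrC ler_pdivlMr ?expR_gt0 //.
apply: le_trans (_ : 16 * C * m.*2%:R * expR 1 * (mu / 2) <= _).
  by rewrite /T le_eqVlt; apply/orP; left; apply/eqP; field.
by apply: ler_pM; rewrite ?(ltW (divr_gt0 mu0 _)) // !mulr_ge0 ?expR_ge0 // ltW.
Qed.

End Concentration.

(** * Overlaps of copies *)

Section Overlaps.
Variables (R : realType) (V : finType) (E : {set {set V}}) (N : nat) (p : R).
Hypothesis p01 : 0 <= p <= 1.
Hypothesis N_gt0 : (0 < N)%N.
Hypothesis E_gt1 : (1 < #|E|)%N.
Hypothesis E_bal : balanced E.
Hypothesis p_le : p <= N%:R `^ (- ((#|V|%:R - 2) / (#|E|%:R - 1))).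

Local Notation K := (complete_edges 'I_N).

Definition copy_index : finType := {S : {set 'I_N} * {set {set 'I_N}} | S \in copies E K}.
Definition copy_edges (a : copy_index) : {set {set 'I_N}} := (val a).2.

Lemma copy_edges_sub a : copy_edges a \subset K.
Proof. by have /copiesP[f _ []] := valP a. Qed.

Lemma card_copy_index_edges a : #|copy_edges a| = #|E|.
Proof.
by rewrite /copy_edges; have /copiesP[f fi [-> _]] := valP a; apply: card_copy_edges.
Qed.

Lemma card_copy_index : #|{: copy_index}| = #|copies E K|.
Proof. by rewrite card_sig; apply: eq_card. Qed.

(** By the upper bound on [p], the product is at most [N] to the power [(v - k) - rho2 * (e - j)],
    where [k] and [j] count the vertices and edges of [B]; balancedness makes this exponent
    nonpositive. *)
Lemma overlap_le1 a (B : {set {set 'I_N}}) : B \subset copy_edges a -> B != set0 ->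
  (N ^ (#|V| - #|cover B|))%:R * p ^+ (#|E| - #|B|) <= 1 :> R.
Proof.
rewrite /copy_edges; have /copiesP[f fi [-> _]] := valP a => /= BF B0.
pose h (e : {set V}) := [set f x | x in e].
(* Balancedness speaks of subgraphs of [E], so [B] is pulled back along the embedding. *)
pose B' := [set e in E | h e \in B].
have BE : B = h @: B'.
  apply/setP => e; apply/idP/imsetP => [eB|[e0]].
    have /imsetP[e0 e0E eE] := subsetP BF e eB.
    by exists e0; rewrite // inE e0E -[h _]eE.
  by rewrite inE => /andP[_ hB] ->.
have cB : #|B| = #|B'| by rewrite BE card_imset //; apply: imset_inj.
have cov : cover B = f @: cover B'.
  rewrite /cover BE; apply/setP => y; apply/bigcupP/imsetP.
    case=> e /imsetP[e0 e0B ->] /imsetP[x xe0 ->]; exists x => //.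
    by apply/bigcupP; exists e0.
  case=> x /bigcupP[e0 e0B xe0] ->; exists (h e0); first exact: imset_f.
  exact: imset_f.
have cC : #|cover B| = #|cover B'| by rewrite cov card_imset.
have B'E : B' \subset E by apply/subsetP => e; rewrite inE => /andP[].
have B'0 : B' != set0 by apply: contraNneq B0 => B'0; rewrite BE B'0 imset0.
have [k1 hbal] := E_bal B'E B'0.
rewrite cB cC; move: k1 hbal (subset_leq_card B'E) (max_card (mem (cover B'))).
have : (0 < #|B'|)%N by rewrite card_gt0.
move: p_le E_gt1.
move: #|B'| #|cover B'| #|V| #|E| => j k v e ple e1 j0 k1 hbal je kv.
have hN : (1 : R) <= N%:R by rewrite ler1n.
have N0 : (0 : R) < N%:R by rewrite ltr0n.
have p0 : 0 <= p by case/andP: p01.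
set r := (v%:R - 2) / (e%:R - 1) : R in ple.
(* Balancedness rearranged: [(e - 1) * (v - k) <= (v - 2) * (e - j)]. *)
have hr : (v - k)%:R <= r * (e - j)%:R :> R.
  rewrite /r mulrAC ler_pdivlMr ?subr_gt0 ?ltr1n //.
  rewrite -(natrB _ (ltnW e1)) -(natrB _ (leq_trans k1 kv)) -!natrM ler_nat.
  by nia.
apply: le_trans (_ : N%:R `^ (v - k)%:R * N%:R `^ (- (r * (e - j)%:R)) <= _).
  rewrite natrX -powR_mulrn ?ler0n // ler_wpM2l ?powR_ge0 //.
  rewrite -mulNr powRrM powR_mulrn ?powR_ge0 //.
  by apply: lerXn2r; rewrite ?nnegrE ?powR_ge0.
rewrite -powRD; last by rewrite (gt_eqF N0) implybT.
by rewrite -[leRHS](powRr0 N%:R) ler_powR // subr_le0.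
Qed.

Definition overlap_const : nat := 2 ^ #|V| * #|V| ^ #|V|.

(** Group the copies by their nonempty intersection [B] with [S], for which there are at most
    [L ^ #|E|] choices. The number of copies containing [B] times their weight is bounded by
    [overlap_const], thanks to [overlap_le1]. *)
Lemma meeting_weight_le (S : {set {set 'I_N}}) L : (#|S| <= L)%N ->
  meeting_weight copy_edges p S <= (overlap_const * L ^ #|E|)%:R.
Proof.
move=> SL; have p0 : 0 <= p by case/andP: p01.
pose sub := [set B : {set {set 'I_N}} | [&& B \subset S, B != set0 & (#|B| <= #|E|)%N]].
rewrite /meeting_weight (partition_big (fun a => copy_edges a :&: S) (mem sub)) /=; last first.
  move=> a; rewrite /meets -setI_eq0 => ne; rewrite inE subsetIr ne /=.
  by rewrite -(card_copy_index_edges a) subset_leq_card ?subsetIl.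
apply: le_trans (_ : \sum_(B in sub) overlap_const%:R <= _); last first.
  rewrite sumr_const -[leLHS]mulr_natl -natrM ler_nat mulnC leq_mul2l.
  apply/orP; right; apply: leq_trans (card_small_subsets S #|E|) _.
  by rewrite leq_exp2r // ltnW.
apply: ler_sum => B; rewrite inE => /and3P[BS B0 BE].
apply: le_trans (_ : \sum_(a | B \subset copy_edges a) p ^+ (#|E| - #|B|) <= _).
  rewrite big_mkcond [leRHS]big_mkcond; apply: ler_sum => a _.
  case: ifP => [/andP[_ /eqP aB]|_]; last by case: ifP => // _; rewrite exprn_ge0.
  by rewrite -aB subsetIl cardsD card_copy_index_edges.
(* [overlap_le1] needs some copy containing [B]; without one the sum is empty. *)
have [a0 a0B|none] := pickP (fun a => B \subset copy_edges a); last first.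
  by rewrite big_pred0.
rewrite sumr_const.
have cle : (#|[pred a | B \subset copy_edges a]| <= overlap_const * N ^ (#|V| - #|cover B|))%N.
  have := card_copies_containing E B; rewrite card_ord mulnA; apply: leq_trans.
  rewrite -(card_imset _ (@val_inj _ _ copy_index)).
  apply: subset_leq_card; apply/subsetP => S' /imsetP[a]; rewrite inE => aB ->.
  by rewrite inE (valP a).
rewrite -[leLHS]mulr_natl.
apply: le_trans (_ : (overlap_const * N ^ (#|V| - #|cover B|))%:R * p ^+ (#|E| - #|B|) <= _).
  by rewrite ler_wpM2r ?exprn_ge0 // ler_nat.
by rewrite natrM -mulrA ler_piMr ?ler0n // (overlap_le1 a0B).
Qed.

Lemma copy_count_contained (H : {set {set 'I_N}}) : H \subset K ->
  copy_count R E H = contained_count R copy_edges H.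
Proof.
move=> HK; rewrite /copy_count /contained_count -natr_sum; congr _%:R.
have -> : copies E H = val @: [set a : copy_index | copy_edges a \subset H].
  apply/setP => S; apply/idP/imsetP => [SH|[a]]; last first.
    have := valP a; rewrite /copy_edges !inE /is_subgraph => /andP[/andP[_ aW] aE] aH ->.
    by rewrite aH aW.
  have SK : S \in copies E K.
    move: SH; rewrite !inE /is_subgraph => /andP[/andP[SH ->] ->].
    by rewrite (subset_trans SH HK).
  exists (exist _ S SK) => //; move: SH; rewrite !inE /is_subgraph /copy_edges /=.
  by case/andP => /andP[].
rewrite card_imset; last exact: val_inj.
by rewrite -sum1_card big_mkcond; apply: eq_bigr => a _; rewrite inE; case: ifP.
Qed.

End Overlaps.

(** * The choice of parameters *)

(** Factor by factor, [n <= 2 * (n - i)] for [i < m]. *)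
Lemma leq_expn_bin n m : (2 * m <= n)%N -> (n ^ m <= 2 ^ m * m`! * 'C(n, m))%N.
Proof.
move=> mn; rewrite -mulnA [(m`! * _)%N]mulnC bin_ffact ffact_prod.
have pc x : (x ^ m = \prod_(i < m) x)%N by rewrite prod_nat_const card_ord.
rewrite !pc -big_split /=; apply: leq_prod => i _.
by have := ltn_ord i; lia.
Qed.

(** If [n < n0], the power of [n] is at most 2, whereas [8 * ln n%:R >= 8 * ln 2 >= 4]. *)
Lemma powR_ln_large (R : realType) (n0 c : R) (n : nat) :
  1 < n0 -> 0 <= c -> c * ln n0 <= ln 2 -> (2 <= n)%N ->
  8 * ln n%:R <= n%:R `^ c -> n0 <= n%:R.
Proof.
move=> n01 c0 hc n2 h; rewrite leNgt; apply/negP => nn0.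
have n0' : 0 < n0 by lra.
have n20 : (2 : R) <= n%:R by rewrite (ler_nat _ 2).
have npos : (0 : R) < n%:R by lra.
(* This is [ln (1 + x) <= x] at [x = - (1 / 2)]. *)
have ln2 : 1 / 2 <= ln (2 : R).
  have := @le_ln1Dx R (- (1 / 2)) _.
  rewrite (_ : 1 + - (1 / 2) = 2^-1); last by field.
  by rewrite lnV ?posrE //; lra.
have le1 : n%:R `^ c <= 2.
  apply: le_trans (ge0_ler_powR c0 _ _ (ltW nn0)) _; rewrite ?nnegrE; try lra.
  by rewrite /powR gt_eqF // -[leRHS](@lnK R) ?posrE // ler_expR.
have : ln 2 <= ln n%:R :> R by rewrite ler_ln ?posrE.
lra.
Qed.

Lemma eq_gnp_tail (R : realType) N (p lambda : R) (X Y : {set {set 'I_N}} -> R) :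
  (forall H : {set {set 'I_N}}, H \subset complete_edges 'I_N -> X H = Y H) ->
  gnp_Pr p (fun H => `|X H - gnp_E p X| >= lambda * Num.sqrt (gnp_Var p X)) =
  gnp_Pr p (fun H => `|Y H - gnp_E p Y| >= lambda * Num.sqrt (gnp_Var p Y)).
Proof.
move=> XY; have EXY : gnp_E p X = gnp_E p Y by apply: eq_gnp_E.
have -> : gnp_Var p X = gnp_Var p Y.
  by rewrite /gnp_Var EXY; apply: eq_gnp_E => H HK; rewrite XY.
apply: eq_bigl => H; rewrite powersetE; case: (boolP (H \subset _)) => // HK.
by rewrite EXY XY.
Qed.

Lemma nat_between_halves (R : realType) (a b : R) : 0 < a -> 2 * a <= b ->
  exists m : nat, a * m%:R <= b <= 2 * a * m%:R.
Proof.
move=> a0 ab; have ba : 2 <= b / a by rewrite ler_pdivlMr.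
have -> : b = a * (b / a) by rewrite mulrC divfK ?gt_eqF.
move: (b / a) ba => y y2.
have y0 : 0 <= y by apply: le_trans y2.
have /andP[my ym] := truncn_itv y0.
exists (Num.truncn y); rewrite ler_pM2l // my (mulrC 2) -mulrA ler_pM2l //.
by move: ym; rewrite -natr1; move: (Num.truncn y)%:R => z; lra.
Qed.

(** With the factor [2 * C * n] set aside, what remains is [2 * C * n ^+ (2 * e + 1) <= mu]. Of the
    two factors in [x * x <= mu * G], one absorbs the constant [2 * C * G] and the other the power
    of [n]. *)
Lemma moment_numerics (R : realType) (C G x mu n : R) (e : nat) :
  0 <= C -> 0 < G -> 0 <= n -> 2 * C * G <= x -> n ^+ (2 * e + 1) <= x ->
  x * x <= mu * G -> (2 * n * (C * n ^+ e)) ^+ 2 <= 2 * C * n * mu.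
Proof.
move=> C0 G0 n0 Bx nx xmu.
have -> : (2 * n * (C * n ^+ e)) ^+ 2 = 2 * C * n * (2 * C * n ^+ (2 * e + 1)).
  by rewrite addn1 [n ^+ _.+1]exprS mulnC exprM; ring.
rewrite ler_wpM2l ?mulr_ge0 // -(ler_pM2r G0) (le_trans _ xmu) // mulrAC.
by apply: ler_pM; rewrite ?exprn_ge0 ?mulr_ge0 // ltW.
Qed.

(** The bound [c2 * (2 * e)%:R <= c1 / 2] controls the power of [lambda]. The bound
    [c2 * ln n0 <= ln 2] forces [n0 <= N%:R] by [powR_ln_large], and [n0] is large enough for the
    other three conclusions. *)
Lemma exists_small_exponent (R : realType) (c1 B K : R) (w e : nat) :
  0 < c1 -> 0 <= B -> exists2 c2 : R, 0 < c2 &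
    forall (N : nat) (lambda : R), (2 <= N)%N ->
      8 * ln N%:R <= lambda <= N%:R `^ c2 ->
      [/\ (w <= N)%N, B <= N%:R `^ (c1 / 2), K <= lambda &
          (lambda ^+ 2) ^+ e <= N%:R `^ (c1 / 2)].
Proof.
(* The summands serve in turn the bound by [B], the bound [w <= N], and, through
   [ln N%:R <= lambda], the bound [K <= lambda]; the 1 makes [ln n0] positive. *)
move=> c10 B0; pose n0 := B `^ (2 / c1) + w%:R + (1 + expR K).
have n01 : 1 < n0.
  by rewrite /n0 ltr_wpDl ?addr_ge0 ?powR_ge0 ?ler0n // ltrDl expR_gt0.
have lnn0 : 0 < ln n0 by apply: ln_gt0.
have ln2 : 0 < ln 2 :> R by apply: ln_gt0; rewrite ltr1n.
have K0 : 0 < 4 * e.+1%:R :> R by rewrite mulr_gt0 // ltr0n.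
exists (Num.min (c1 / (4 * e.+1%:R)) (ln 2 / ln n0)); first by rewrite lt_min !divr_gt0.
set c2 := Num.min _ _ => N lambda N2 /andP[llo lhi].
have c2ge0 : 0 <= c2 by rewrite le_min !divr_ge0 // ltW.
have c2le : c2 * (2 * e)%:R <= c1 / 2.
  apply: le_trans (_ : c1 / (4 * e.+1%:R) * (2 * e.+1%:R) <= _).
    by rewrite ler_pM ?ler0n // ?ge_min ?lexx // natrM ler_wpM2l // ler_nat.
  by rewrite le_eqVlt; apply/orP; left; apply/eqP; field; rewrite nat1r pnatr_eq0.
have c2ln : c2 * ln n0 <= ln 2 by rewrite -ler_pdivlMr // ge_min lexx orbT.
have n0N : n0 <= N%:R by apply: powR_ln_large c2ln N2 (le_trans llo lhi).
have N1 : (1 : R) <= N%:R by rewrite ler1n ltnW.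
have lnN0 : 0 <= ln N%:R :> R by rewrite ln_ge0.
have lnNl : ln N%:R <= lambda by apply: le_trans llo; rewrite ler_peMl // ler1n.
split.
- rewrite -(ler_nat R); apply: le_trans n0N; rewrite /n0 addrAC lerDr.
  by rewrite !addr_ge0 ?powR_ge0 ?expR_ge0.
- have h : B `^ (2 / c1) <= N%:R.
    by apply: le_trans n0N; rewrite /n0 -addrA lerDl !addr_ge0 ?expR_ge0 ?ler0n.
  have c120 : 0 <= c1 / 2 by rewrite divr_ge0 // ltW.
  have := ge0_ler_powR c120 _ _ h; rewrite !nnegrE powR_ge0 ler0n => /(_ isT isT).
  rewrite -powRrM (_ : 2 / c1 * (c1 / 2) = 1) ?powRr1 //.
  by field; rewrite gt_eqF.
- apply: le_trans lnNl; rewrite -ler_expR lnK ?posrE ?(lt_le_trans ltr01) //.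
  by apply: le_trans n0N; rewrite /n0 addrA lerDr !addr_ge0 ?powR_ge0 ?ler0n.
- apply: le_trans (_ : (N%:R `^ c2 ^+ 2) ^+ e <= _).
    apply: lerXn2r; rewrite ?nnegrE ?sqr_ge0 //.
    by apply: lerXn2r; rewrite ?nnegrE ?powR_ge0 // (le_trans lnN0).
  by rewrite -exprM -powR_mulrn ?powR_ge0 // -powRrM ler_powR.
Qed.

(** * The tail bound for large [N] and admissible [p] *)

Section Subgaussian.
Variables (R : realType) (V : finType) (E : {set {set V}}) (N : nat) (p c1 : R).
Hypothesis E_simple : simple_graph E.
Hypothesis E_bal : balanced E.
Hypothesis E_gt1 : (1 < #|E|)%N.
Hypothesis V_gt1 : (1 < #|V|)%N.
Hypothesis p01 : 0 <= p <= 1.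
Hypothesis c1_gt0 : 0 < c1.
Hypothesis N_large : (2 * #|V| <= N)%N.
Hypothesis p_ge : N%:R `^ (- (#|V|%:R / #|E|%:R) + c1) <= p.
Hypothesis p_le : p <= N%:R `^ (- ((#|V|%:R - 2) / (#|E|%:R - 1)) - c1).

Local Notation mu := (#|{: copy_index E N}|%:R * p ^+ #|E|).

Let N_gt0 : (0 < N)%N.
Proof. by apply: leq_trans N_large; rewrite muln_gt0 (ltnW V_gt1). Qed.

Let N_ge1 : (1 : R) <= N%:R.
Proof. by rewrite ler1n. Qed.

Let N_neq0 : (N%:R : R) != 0.
Proof. by rewrite pnatr_eq0 -lt0n. Qed.

(** There are at least ['C(N, v)] copies, a constant fraction of [N ^ v], and the lower bound on [p]
    makes [p ^+ e] at least [N] to the power [- v + c1 * e]; finally [e >= 1]. *)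
Lemma powR_le_mean : N%:R `^ c1 <= mu * (2 ^ #|V| * #|V|`!)%:R.
Proof.
have e_ge1 : (1 : R) <= #|E|%:R by rewrite ler1n ltnW.
apply: le_trans (_ : N%:R `^ (#|V|%:R + (- (#|V|%:R / #|E|%:R) + c1) * #|E|%:R) <= _).
  rewrite ler_powR // mulrDl mulNr divfK ?gt_eqF ?(lt_le_trans ltr01) // addNKr.
  by rewrite -[leLHS]mulr1 ler_wpM2l // ltW.
rewrite powRD ?N_neq0 ?implybT // mulrAC powRrM !powR_mulrn ?powR_ge0 ?ler0n //.
apply: ler_pM; rewrite ?exprn_ge0 ?powR_ge0 ?ler0n //; last first.
  by apply: lerXn2r; rewrite ?nnegrE ?powR_ge0 //; case/andP: p01.
rewrite -natrX -natrM ler_nat mulnC; apply: leq_trans (leq_expn_bin N_large) _.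
rewrite leq_mul2l card_copy_index; apply/orP; right.
by have := card_copies_ge 'I_N E_simple; rewrite card_ord.
Qed.

Lemma copy_prob_le_half : 2 <= N%:R `^ c1 -> p ^+ #|E| <= 2^-1.
Proof.
move=> N2; apply: le_trans (_ : p ^+ 1 <= _).
  by case/andP: p01 => p0 p1; rewrite ler_wiXn2l // ltnW.
apply: le_trans p_le _; apply: le_trans (_ : N%:R `^ (- c1) <= _).
  rewrite ler_powR // -[leRHS]add0r lerD2r oppr_le0 divr_ge0 // subr_ge0.
    by rewrite (ler_nat _ 2).
  by rewrite ler1n ltnW.
by rewrite powRN lef_pV2 ?posrE ?powR_gt0 ?ltr0n.
Qed.

Lemma subgaussian_tail (k g : nat) (lambda : R) :
  k = (overlap_const V * #|E| ^ #|E|)%N -> g = (2 ^ #|V| * #|V|`!)%N ->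
  2 * k%:R * g%:R <= N%:R `^ (c1 / 2) ->
  (lambda ^+ 2) ^+ (2 * #|E| + 1) <= N%:R `^ (c1 / 2) ->
  64 * (k%:R * expR 1) <= lambda ->
  gnp_Pr p (fun H : {set {set 'I_N}} => `|copy_count R E H - gnp_E p (@copy_count R V E N)|
      >= lambda * Num.sqrt (gnp_Var p (@copy_count R V E N)))
    <= expR (- (64 * (k%:R * expR 1))^-1 * lambda ^+ 2).
Proof.
move=> kE gE Bx lx lK.
have k1 : (1 : R) <= k%:R by rewrite ler1n kE !muln_gt0 !expn_gt0 (ltnW V_gt1) (ltnW E_gt1).
have g1 : (1 : R) <= g%:R by rewrite ler1n gE muln_gt0 expn_gt0 fact_gt0.
have e1 : 1 <= expR 1 :> R by rewrite -[leLHS]expR0 ler_expR.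
have ke1 : 1 <= k%:R * expR 1 :> R by rewrite -[leLHS]mulr1 ler_pM.
have kg1 : 1 <= k%:R * g%:R :> R by rewrite -[leLHS]mulr1 ler_pM.
have := powR_le_mean; rewrite -gE.
have -> : N%:R `^ c1 = N%:R `^ (c1 / 2) * N%:R `^ (c1 / 2).
  by rewrite -powRD ?N_neq0 ?implybT // -splitr.
have := copy_prob_le_half.
have -> : N%:R `^ c1 = N%:R `^ (c1 / 2) * N%:R `^ (c1 / 2).
  by rewrite -powRD ?N_neq0 ?implybT // -splitr.
move: (N%:R `^ (c1 / 2)) Bx lx => x Bx lx half xmu.
have x2 : 2 <= x by apply: le_trans Bx; rewrite -mulrA ler_peMr.
have xx : 2 <= x * x by rewrite -[leLHS]mulr1 ler_pM // (le_trans _ x2) // ler1n.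
have mu0 : 0 < mu.
  rewrite -(pmulr_lgt0 _ (lt_le_trans ltr01 g1)).
  by apply: lt_le_trans xmu; apply: lt_le_trans xx.
have ke0 : 0 < k%:R * expR 1 :> R by apply: lt_le_trans ke1.
have l1 : 1 <= lambda.
  by apply: le_trans lK; apply: le_trans ke1 _; rewrite ler_peMl ?ler1n // ltW.
have l0 : 0 < lambda by apply: lt_le_trans l1.
(* The left inequality is the condition of [count_tail] on [lambda], with 32 = 16 * 2 because the
   moment order is [m.*2]; the right one converts [expR (- m%:R)] into the claimed bound. *)
have [m /andP[ml lm]] : exists m : nat,
    32 * (k%:R * expR 1) * m%:R <= lambda ^+ 2 <= 2 * (32 * (k%:R * expR 1)) * m%:R.
  apply: nat_between_halves; first by rewrite mulr_gt0.
  apply: le_trans (_ : lambda <= _); first by rewrite mulrA -natrM.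
  by rewrite expr2 ler_peMl // ltW.
have m2 : m.*2%:R = 2 * m%:R :> R by rewrite -mul2n natrM.
have nl : m.*2%:R <= lambda ^+ 2.
  apply: le_trans ml; rewrite m2 ler_wpM2r // -[leLHS]mulr1 ler_pM // ler_nat //.
rewrite (eq_gnp_tail p lambda (Y := contained_count R (@copy_edges V E N))); last first.
  by move=> H HK; apply: copy_count_contained.
have p_le' : p <= N%:R `^ (- ((#|V|%:R - 2) / (#|E|%:R - 1))).
  by apply: le_trans p_le _; rewrite ler_powR // lerBlDr lerDl ltW.
apply: le_trans (_ : expR (- m%:R) <= _); last first.
  rewrite ler_expR mulNr lerN2 mulrC ler_pdivrMr; last first.
    by rewrite mulr_gt0.
  by apply: le_trans lm _; rewrite mulrA -natrM [leRHS]mulrC.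
(* A single copy has [#|E|] edges, whence the constant [k]. Explored sets have up to [#|E| * m.*2]
   edges, whence the extra factor [m.*2%:R ^+ #|E|]. *)
apply: (@count_tail _ _ _ p01 _ _ #|E| _ _ m k%:R (k%:R * m.*2%:R ^+ #|E|)) => //.
- exact: copy_edges_sub.
- exact: card_copy_index_edges.
- exact: half.
- exact: lt_le_trans k1.
- by rewrite mulr_ge0 // exprn_ge0.
- by move=> a; rewrite kE; apply: meeting_weight_le => //; rewrite card_copy_index_edges.
- move=> S hS; apply: le_trans (meeting_weight_le _ _ _ _ _ hS) _ => //.
  by rewrite kE expnMn mulnA natrM natrX.
- apply: (@moment_numerics _ _ g%:R x) => //.
  + exact: lt_le_trans g1.
  + by apply: le_trans lx; apply: lerXn2r; rewrite ?nnegrE ?sqr_ge0.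
- apply: le_trans ml; rewrite m2 le_eqVlt; apply/orP; left; apply/eqP; ring.
Qed.

End Subgaussian.

Theorem theorem1p2 (R : realType) (V : finType) (E : {set {set V}})
    (E_simple : simple_graph E)
    (E_shape : complete_graph E \/ complete_bipartite_graph E)
    (E_ge3 : (3 <= #|E|)%N) :
  let rho1 : R := #|V|%:R / #|E|%:R in
  let rho2 : R := (#|V|%:R - 2) / (#|E|%:R - 1) in
  exists2 cG : R, 0 < cG &
    forall c1 : R, 0 < c1 ->
    exists2 c2 : R, 0 < c2 &
      forall (N : nat) (p lambda : R),
        (2 <= N)%N ->
        0 <= p <= 1 ->
        N%:R `^ (- rho1 + c1) <= p <= N%:R `^ (- rho2 - c1) ->
        8 * ln N%:R <= lambda <= N%:R `^ c2 ->
        let X : {set {set 'I_N}} -> R := @copy_count R V E N in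
        gnp_Pr p (fun H => `|X H - gnp_E p X| >= lambda * Num.sqrt (gnp_Var p X))
          <= expR (- cG * lambda ^+ 2).
Proof.
move=> rho1 rho2.
have bal : balanced E.
  by case: E_shape; [apply: complete_balanced|apply: bipartite_balanced].
have E_gt1 : (1 < #|E|)%N by apply: ltnW.
(* Balancedness applied to [E] itself. *)
have V_gt1 : (1 < #|V|)%N.
  have E0 : E != set0 by rewrite -card_gt0 ltnW.
  by have [k _] := bal E (subxx _) E0; exact: leq_trans k (max_card _).
pose C : R := (overlap_const V * #|E| ^ #|E|)%:R.
have C0 : 0 < C.
  by rewrite ltr0n !muln_gt0 !expn_gt0 (ltnW V_gt1) (ltnW E_gt1).
exists (64 * (C * expR 1))^-1; first by rewrite invr_gt0 !mulr_gt0 ?expR_gt0.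
move=> c1 c1_gt0.
have [|c2 c2_gt0 hc2] := @exists_small_exponent R c1 (2 * C * (2 ^ #|V| * #|V|`!)%:R)
   (64 * (C * expR 1)) (2 * #|V|)%N (2 * #|E| + 1)%N c1_gt0.
  by rewrite !mulr_ge0 // ltW.
exists c2 => // N p lambda N2 p01 /andP[plo phi] /(hc2 N lambda N2)[wN BN Kl lN].
exact: (subgaussian_tail E_simple bal E_gt1 V_gt1 p01 c1_gt0 wN plo phi erefl erefl BN lN Kl).
Qed.
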